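(* Let $(x^*,y^*,\mu^* )$ be a solution to RMP for which $\mu^*_p=Q_p(x^*,y^* )$ for some $p\in\mathcal P$. Then, for any solution $(\bar x,\bar y,\bar\mu)$ to RMP, the optimality cut $\mathrm{Cut}_p(\bar x,\bar y)$ generated for $(\bar x,\bar y,\bar\mu)$ and the same $p$ is satisfied by $(x^*,y^*,\mu^* )$.
   Context: Data. $\mathcal P$ (products) and $\mathcal F$ (facilities) are finite sets. Facility $f$ has capacity $B_f\ge 0$. For $p\in\mathcal P,f\in\mathcal F$, $\mathcal L_{pf}$ is a finite set of production levels; level $l$ has bounds $0\le L_{pfl}\le U_{pfl}$; the intervals $[L_{pfl},U_{pfl}]$, $l\in\mathcal L_{pf}$, are pairwise disjoint and some level has $L_{pfl}=U_{pfl}=0$. $C_{pf}$ is a unit cost, $P_p$ the full price, $O_p$ the discounted price, with $0\le O_p<P_p$ and $O_p<C_{pf}$ for all $f$. For each $p$, $\mathcal D_p$ is a finite set of distributions, and $l(p,f,d)\in\mathcal L_{pf}$ is the level at facility $f$ associated with $d\in\mathcal D_p$; for each $p$, every combination of levels $(l_f)_{f\in\mathcal F}$, $l_f\in\mathcal L_{pf}$, determines exactly one $d\in\mathcal D_p$ with $l(p,f,d)=l_f$ for all $f$. Each $d\in\mathcal D_p$ has a finite scenario set $\mathcal S_{pd}$ with probabilities $\pi_{sd}\ge 0$ summing to $1$; in scenario $s$ the yield at $f$ is $Y_{pfds}\ge 0$ and the demand is $D_{pds}\ge 0$. Variables: $x_{pf}\ge 0$, $y_{pfl}\in\{0,1\}$,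 $\mu_p$. First-stage constraints: $\sum_{p}x_{pf}\le B_f$ for all $f$; $\sum_{l\in\mathcal L_{pf}}y_{pfl}=1$ and $\sum_l L_{pfl}y_{pfl}\le x_{pf}\le\sum_l U_{pfl}y_{pfl}$ for all $p,f$. For $y$ satisfying these, $d_p(y)$ is the unique $d\in\mathcal D_p$ with $y_{p,f,l(p,f,d)}=1$ for all $f$. Expected revenue: with $d=d_p(y)$ and $z_{pds}=\sum_{f}Y_{pfds}x_{pf}$, $Q_p(x,y)=\sum_{s\in\mathcal S_{pd}}\pi_{sd}\,\max\{P_pw+O_po: w+o=z_{pds},\ w\le D_{pds},\ w,o\ge0\}$, where the maximum equals $P_p\min\{D_{pds},z_{pds}\}+O_p\max\{z_{pds}-D_{pds},0\}$. Bound: with $\bar Z_{pds}=\sum_f Y_{pfds}\min\{B_f,U_{p,f,l(p,f,d)}\}$, $M_p=\max_{d\in\mathcal D_p}\sum_{s\in\mathcal S_{pd}}\pi_{sd}\big(P_p\min\{D_{pds},\bar Z_{pds}\}+O_p\max\{\bar Z_{pds}-D_{pds},0\}\big)$. RMP (relaxed master problem): maximize $-\sum_{p}\sum_f C_{pf}x_{pf}+\sum_p\mu_p$ subject to the first-stage constraints and $0\le\mu_p\le M_p$ for all $p$. A solution to RMP is a point $(x,y,\mu)$ satisfying its constraints. Scenario partition: for first-stage feasible $(\bar x,\bar y)$ and $d=d_p(\bar y)$, $\mathcal S^{\uparrow}_{pd}(\bar x,\bar y)=\{s\in\mathcal S_{pd}: D_{pds}<\sum_fY_{pfds}\bar x_{pf}\}$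 and $\mathcal S^{\downarrow}_{pd}(\bar x,\bar y)=\mathcal S_{pd}\setminus\mathcal S^{\uparrow}_{pd}(\bar x,\bar y)$. Optimality cut $\mathrm{Cut}_p(\bar x,\bar y)$: the inequality in $(x,y,\mu)$, with $d=d_p(\bar y)$, $$\mu_p \le \sum_{s\in\mathcal S^{\downarrow}_{pd}(\bar x,\bar y)}\pi_{sd}\Big(P_p\sum_{f}Y_{pfds}x_{pf}\Big)+\sum_{s\in\mathcal S^{\uparrow}_{pd}(\bar x,\bar y)}\pi_{sd}\Big(O_p\sum_{f}Y_{pfds}x_{pf}+(P_p-O_p)D_{pds}\Big)+M_p\Big(|\mathcal F|-\sum_{f}y_{p,f,l(p,f,d)}\Big).$$ *)

(* Defs.v *)
From HB Require Import structures.
From mathcomp Require Import all_boot all_order all_algebra.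
From mathcomp Require Import boolp classical_sets reals ring.

Set Implicit Arguments.
Unset Strict Implicit.
Unset Printing Implicit Defensive.

Import Order.TTheory GRing.Theory Num.Theory.
Local Open Scope ring_scope.

Record instance (R : realType) := Instance {
  product : finType;
  facility : finType;
  level : product -> facility -> finType;
  distribution : product -> finType;
  scenario : forall p : product, distribution p -> finType;
  capacity : facility -> R;
  lower : forall (p : product) (f : facility), level p f -> R;
  upper : forall (p : product) (f : facility), level p f -> R;
  cost : product -> facility -> R;
  price : product -> R;
  discount : product -> R;
  level_of : forall (p : product) (f : facility), distribution p -> level p f;
  prob : forall (p : product) (d : distribution p), scenario d -> R;
  yield : forall (p : product) (f : facility) (d : distribution p),
    scenario d -> R;
  demand : forall (p : product) (d : distribution p), scenario d -> R;
  capacity_ge0 : forall f, 0 <= capacity f;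
  lower_ge0 : forall p f (l : level p f), 0 <= lower l;
  lower_le_upper : forall p f (l : level p f), lower l <= upper l;
  levels_disjoint : forall p f (l l' : level p f) (t : R), l != l' ->
    ~ (lower l <= t <= upper l /\ lower l' <= t <= upper l');
  zero_level : forall p f, exists l : level p f, lower l = 0 /\ upper l = 0;
  discount_ge0 : forall p, 0 <= discount p;
  discount_lt_price : forall p, discount p < price p;
  discount_lt_cost : forall p f, discount p < cost p f;
  level_combination : forall p (l : forall f, level p f),
    exists! d : distribution p, forall f, level_of f d = l f;
  prob_ge0 : forall p (d : distribution p) (s : scenario d), 0 <= prob s;
  prob_sum1 : forall p (d : distribution p), \sum_(s : scenario d) prob s = 1;
  yield_ge0 : forall p f (d : distribution p) (s : scenario d),
    0 <= yield f s;
  demand_ge0 : forall p (d : distribution p) (s : scenario d), 0 <= demand s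
}.

Arguments capacity {R i} f.
Arguments lower {R i p f} l.
Arguments upper {R i p f} l.
Arguments cost {R i} p f.
Arguments price {R i} p.
Arguments discount {R i} p.
Arguments level_of {R i p} f d.
Arguments prob {R i p d} s.
Arguments yield {R i p} f {d} s.
Arguments demand {R i p d} s.

Section Model.
Context {R : realType} {I : instance R}.
Implicit Types (p : product I) (f : facility I).

Definition production := product I -> facility I -> R.
Definition selection := forall p f, level p f -> bool.
Definition revenue_estimate := product I -> R.

Definition first_stage_feasible (x : production) (y : selection) : Prop :=
  [/\ forall p f, 0 <= x p f,
      forall f, \sum_p x p f <= capacity f,
      forall p f, \sum_(l : level p f) (y p f l)%:R = 1 :> R
    & forall p f, \sum_(l : level p f) lower l * (y p f l)%:R <= x p f
                  <= \sum_(l : level p f) upper l * (y p f l)%:R].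

Lemma distribution_inhabited p : exists d : distribution p, xpredT d.
Proof.
have l f : {l : level p f | lower l = 0 /\ upper l = 0}.
  exact/cid/zero_level.
by have [d _] := level_combination (fun f => sval (l f)); exists d.
Qed.

Definition default_distribution p : distribution p :=
  xchoose (distribution_inhabited p).

(* d_p(y); the default is irrelevant when y is feasible,
   see [selected_distributionP]. *)
Definition selected_distribution p (y : selection) : distribution p :=
  odflt (default_distribution p)
        [pick d : distribution p | [forall f, y p f (level_of f d)]].

Lemma selected_distributionP p (x : production) (y : selection) :
  first_stage_feasible x y ->
  forall d : distribution p,
    (forall f, y p f (level_of f d)) <-> d = selected_distribution p y.
Proof.
case=> _ _ y1 _.
have yex f : exists l, y p f l.
  apply/existsP; apply: contraT; rewrite negb_exists => /forallP yN.
  have /eqP := y1 p f; rewrite big1 ?(eq_sym 0) ?oner_eq0// => l _.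
  by rewrite (negbTE (yN l)).
have yuniq f l l' : y p f l -> y p f l' -> l = l'.
  move=> yl yl'; apply/eqP; apply: contraT => ll'.
  have /eqP := y1 p f.
  rewrite (bigD1 l)//= (bigD1 l')/=; last by rewrite eq_sym.
  rewrite yl yl' -[X in _ == X]addr0 (inj_eq (addrI _)) gt_eqF//.
  by rewrite ltr_pwDl ?ltr01// sumr_ge0.
pose l f := sval (cid (yex f)).
have yl f : y p f (l f) by exact: svalP (cid (yex f)).
have [d0 [d0l d0u]] := level_combination l.
have dP (d : distribution p) : (forall f, y p f (level_of f d)) -> d0 = d.
  by move=> yd; apply: d0u => f; apply: yuniq (yd f) (yl f).
have yd0 f : y p f (level_of f d0) by rewrite d0l.
suff <- : d0 = selected_distribution p y by move=> d; split=> [/dP|->].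
rewrite /selected_distribution; case: pickP => [d /forallP/dP//|/(_ d0)].
by move/forallP.
Qed.

Definition supply p (d : distribution p) (s : scenario d) (x : production) : R :=
  \sum_f yield f s * x p f.

Definition sales_revenues p (D z : R) : set R :=
  [set r | exists w o : R, [/\ w + o = z, w <= D, 0 <= w, 0 <= o
                             & r = price p * w + discount p * o]]%classic.

Definition closed_revenue p (D z : R) : R :=
  price p * Num.min D z + discount p * Num.max (z - D) 0.

(* The supremum is a maximum, see [max_revenueP]. *)
Definition max_revenue p (D z : R) : R := sup (sales_revenues p D z).

Lemma max_revenueP p (D z : R) : 0 <= D -> 0 <= z ->
  [/\ sales_revenues p D z (max_revenue p D z),
      ubound (sales_revenues p D z) (max_revenue p D z)
    & max_revenue p D z = closed_revenue p D z].
Proof.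
move=> D0 z0; have /ltW OP := discount_lt_price p.
have inS : sales_revenues p D z (closed_revenue p D z).
  exists (Num.min D z), (Num.max (z - D) 0); split => //.
  - by case: (leP D z) => Dz; [rewrite max_l ?subr_ge0// subrKC
      | rewrite max_r ?addr0// subr_le0 ltW].
  - by rewrite ge_min lexx.
  - by rewrite le_min D0.
  - by rewrite le_max lexx orbT.
have ubS : ubound (sales_revenues p D z) (closed_revenue p D z).
  move=> r [w [o [woz wD w0 o0 ->]]]; rewrite /closed_revenue.
  have -> : Num.max (z - D) 0 = z - Num.min D z.
    by case: (leP D z) => Dz; [rewrite max_l ?subr_ge0
      | rewrite max_r ?subrr// subr_le0 ltW].
  have wm : w <= Num.min D z by rewrite le_min wD -woz lerDl.
  have -> : o = z - w by rewrite -woz addrAC subrr add0r.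
  rewrite -subr_ge0.
  have -> : price p * Num.min D z + discount p * (z - Num.min D z)
      - (price p * w + discount p * (z - w))
      = (price p - discount p) * (Num.min D z - w). by ring.
  by rewrite mulr_ge0 ?subr_ge0.
suff E : max_revenue p D z = closed_revenue p D z by rewrite E; split.
apply/eqP; rewrite eq_le; apply/andP; split.
  by apply: ge_sup => //; exists (closed_revenue p D z).
by apply: ub_le_sup => //; exists (closed_revenue p D z).
Qed.

Definition expected_revenue p (x : production) (y : selection) : R :=
  \sum_(s : scenario (selected_distribution p y))
    prob s * max_revenue p (demand s) (supply s x).

Definition supply_bound p (d : distribution p) (s : scenario d) : R :=
  \sum_f yield f s * Num.min (capacity f) (upper (level_of f d)).

Definition distribution_bound p (d : distribution p) : R :=
  \sum_(s : scenario d) prob s * closed_revenue p (demand s) (supply_bound s).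

Definition revenue_bound p : R :=
  distribution_bound
    [arg max_(d > default_distribution p) distribution_bound d]%O.

(* Feasibility for the relaxed master problem; its objective plays no role. *)
Definition rmp_solution
    (x : production) (y : selection) (mu : revenue_estimate) : Prop :=
  first_stage_feasible x y /\ forall p, 0 <= mu p <= revenue_bound p.

Definition surplus_scenarios p (x : production) (y : selection) :
    {set scenario (selected_distribution p y)} :=
  [set s | demand s < supply s x].

Definition shortage_scenarios p (x : production) (y : selection) :
    {set scenario (selected_distribution p y)} :=
  ~: surplus_scenarios p x y.

(* The cut generated at (xb, yb), as a condition on (x, y, mu). *)
Definition optimality_cut p (xb : production) (yb : selection)
    (x : production) (y : selection) (mu : revenue_estimate) : Prop :=
  let d := selected_distribution p yb in
  mu p <=
    \sum_(s in shortage_scenarios p xb yb) prob s * (price p * supply s x)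
    + \sum_(s in surplus_scenarios p xb yb)
        prob s * (discount p * supply s x
                  + (price p - discount p) * demand s)
    + revenue_bound p
        * (#|facility I|%:R - \sum_f (y p f (level_of f d))%:R).

End Model.

Arguments production {R} I.
Arguments selection {R} I.
Arguments revenue_estimate {R} I.

(* Main.v *)
Require Import Defs.
From mathcomp Require Import all_boot all_order all_algebra.
From mathcomp Require Import reals.
From mathcomp Require Import lra.

(** The revenue [price p * min D z + discount p * max (z - D) 0] is a concave
    piecewise linear function of the supply [z]: it is the minimum of its two
    linear pieces ([closed_revenue_min]).  The right-hand side of a cut, big-M
    term aside, picks one of these pieces in every scenario, according to how
    the demand compares with the supply at the point generating the cut.

    If the point [(xs, ys)] selects the distribution [d] of the cut, then
    whichever pieces were picked, their expectation is at least the expected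
    revenue at [(xs, ys)] ([revenue_le_cut]), which is [mus p]; the big-M term
    vanishes.  Otherwise [ys] misses the level of [d] at some facility, so the
    big-M term is at least [revenue_bound p] ([count_missing_ge1]; this bound
    is nonnegative since [0 <= mus p <= revenue_bound p]), hence at least
    [mus p]; the rest of the right-hand side is nonnegative ([cut_ge0]). *)

Import Order.TTheory GRing.Theory Num.Theory.
Local Open Scope ring_scope.

Lemma closed_revenue_min (R : realType) (I : instance R) (p : product I)
    (D z : R) :
  closed_revenue p D z
  = Num.min (price p * z) (discount p * z + (price p - discount p) * D).
Proof.
have OP := discount_lt_price p; rewrite /closed_revenue.
case: (leP D z) => Dz.
  by rewrite max_l ?subr_ge0// min_r; nra.
by rewrite max_r ?subr_le0 ?(ltW Dz)// min_l; nra.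
Qed.

Lemma supply_ge0 (R : realType) (I : instance R) (p : product I)
    (d : distribution p) (s : scenario d) (x : production I) :
  (forall q f, 0 <= x q f) -> 0 <= supply s x.
Proof. by move=> x0; apply: sumr_ge0 => f _; rewrite mulr_ge0 ?yield_ge0. Qed.

(** [A] is the set of scenarios in which the surplus piece is used.  It is
    arbitrary because in a cut it comes from the supply at another point. *)
Lemma revenue_le_cut (R : realType) (I : instance R) (p : product I)
    (d : distribution p) (A : {set scenario d}) (x : production I) :
  (forall q f, 0 <= x q f) ->
  \sum_(s : scenario d) prob s * max_revenue p (demand s) (supply s x)
  <= \sum_(s in ~: A) prob s * (price p * supply s x)
     + \sum_(s in A) prob s * (discount p * supply s x
                               + (price p - discount p) * demand s).
Proof.
move=> x0; rewrite (bigID (mem A)) /= addrC.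
rewrite [X in _ <= X + _](eq_bigl (fun s => s \notin A)); last first.
  by move=> s; rewrite inE.
by apply: lerD; apply: ler_sum => s _; rewrite ler_wpM2l ?prob_ge0//;
  have [_ _ ->] := max_revenueP p (demand_ge0 s) (supply_ge0 _ _ _ _ s x x0);
  rewrite closed_revenue_min ge_min lexx ?orbT.
Qed.

Lemma cut_ge0 (R : realType) (I : instance R) (p : product I)
    (d : distribution p) (A : {set scenario d}) (x : production I) :
  (forall q f, 0 <= x q f) ->
  0 <= \sum_(s in ~: A) prob s * (price p * supply s x)
       + \sum_(s in A) prob s * (discount p * supply s x
                                 + (price p - discount p) * demand s).
Proof.
move=> x0; have O0 := discount_ge0 p; have OP := discount_lt_price p.
have P0 := le_trans O0 (ltW OP).
apply: addr_ge0; apply: sumr_ge0 => s _; rewrite mulr_ge0 ?prob_ge0//.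
  by rewrite mulr_ge0// supply_ge0.
by rewrite addr_ge0// mulr_ge0 ?subr_ge0 ?(ltW OP) ?supply_ge0 ?demand_ge0.
Qed.

Lemma count_missing_ge1 (R : numDomainType) (T : finType) (b : pred T)
    (t : T) : ~~ b t -> 1 <= #|T|%:R - \sum_i (b i)%:R :> R.
Proof.
move=> bt; rewrite -natr_sum lerBrDr nat1r ler_nat.
rewrite -sum1_card (bigD1 t)// [leqRHS](bigD1 t)//= (negbTE bt) add0n add1n ltnS.
by apply: leq_sum => i _; case: (b i).
Qed.

Theorem proposition6 (R : realType) (I : instance R) (p : product I)
    (xs : production I) (ys : selection I) (mus : revenue_estimate I)
    (hs : rmp_solution xs ys mus)
    (hQ : mus p = expected_revenue p xs ys)
    (xb : production I) (yb : selection I) (mub : revenue_estimate I)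
    (hb : rmp_solution xb yb mub) :
  optimality_cut p xb yb xs ys mus.
Proof.
have [hf /(_ p)/andP[mu0 muM]] := hs.
have [x0 _ _ _] := hf.
rewrite /optimality_cut /shortage_scenarios.
(* From here on, only [d] matters, not the partition made at [(xb, yb)]. *)
set A := surplus_scenarios p xb yb; move: A.
set d := selected_distribution p yb => A.
have [/forallP yd|] := boolP [forall f, ys p f (level_of f d)].
  have dE : d = selected_distribution p ys.
    exact/(selected_distributionP hf d).
  rewrite [X in _ * (_ - X)](eq_bigr (fun=> 1)); last by move=> f _; rewrite yd.
  rewrite sumr_const subrr mulr0 addr0 hQ /expected_revenue -dE.
  exact: revenue_le_cut.
rewrite negb_forall => /existsP[f yf].
apply: (le_trans muM); rewrite -[leLHS]add0r; apply: lerD; first exact: cut_ge0.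
apply: ler_peMr; first exact: le_trans mu0 muM.
exact: (@count_missing_ge1 _ _ (fun g => ys p g (level_of g d)) f).
Qed.
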